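(* Let $A = \begin{bmatrix} a_{11} & a_{12}\\ a_{21} & a_{22} \end{bmatrix}$ be a real $2\times 2$ matrix with all entries strictly positive and $\det(A)\neq 0$. Let $\mathbf{R}=(R_1,R_2)^\top\in\mathbb{R}^2_{>0}$ and $\mathbf{C}=(C_1,C_2)^\top\in\mathbb{R}^2_{>0}$ be target row and column sums with $R_1+R_2=C_1+C_2$. Put $\alpha=a_{11}a_{22}$, $\beta=a_{12}a_{21}$ (so $\det(A)=\alpha-\beta$), and $$\Delta = \bigl(\alpha (C_2+R_2)+\beta (C_1-R_2)\bigr)^2- 4 \alpha C_2 R_2 \det(A).$$ Then the generalized Sinkhorn limit of $A$ with target row sums $\mathbf{R}$ and target column sums $\mathbf{C}$ is $$\operatorname{Sink}(A\mid \mathbf{R},\mathbf{C})=\begin{bmatrix} \dfrac{\alpha(R_2 - 2 C_1 - C_2)+\beta(- R_2 + C_1)+\sqrt{\Delta}}{-2\det(A)} & \dfrac{\alpha(R_2 - C_2)+\beta(-R_2 + C_1 + 2 C_2)-\sqrt{\Delta}}{-2\det(A)} \\[2ex] \dfrac{\alpha(-R_2+C_2)+\beta(R_2+C_1)-\sqrt{\Delta}}{-2\det(A)} & \dfrac{\alpha(-R_2-C_2)+\beta(R_2-C_1)+\sqrt{\Delta}}{-2\det(A)} \end{bmatrix}.$$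
   Context: Generalized Sinkhorn limit: let $A\in\mathbb{R}^{n\times m}_{>0}$ be a matrix with strictly positive entries, and let $\mathbf{R}\in\mathbb{R}^n_{>0}$, $\mathbf{C}\in\mathbb{R}^m_{>0}$ satisfy the consistency condition $\sum_i R_i=\sum_j C_j$. The generalized Sinkhorn limit $\operatorname{Sink}(A\mid\mathbf{R},\mathbf{C})$ is the matrix $S=D_1AD_2$, where $D_1=\operatorname{diag}(r_1,\dots,r_n)$ and $D_2=\operatorname{diag}(c_1,\dots,c_m)$ are diagonal matrices with strictly positive diagonal entries such that $S\mathbf{1}_m=\mathbf{R}$ and $S^\top\mathbf{1}_n=\mathbf{C}$; here $\mathbf{1}_k$ is the column vector of $k$ ones. It is a known theorem of Sinkhorn that such $D_1,D_2$ exist and are unique up to $D_1\mapsto\lambda D_1$, $D_2\mapsto\lambda^{-1}D_2$ with $\lambda>0$, so that $S$ exists and is unique. *)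

(* Defs.v *)
From mathcomp Require Import all_boot all_order all_algebra.
From mathcomp Require Import all_classical reals.

Set Implicit Arguments.
Unset Strict Implicit.
Unset Printing Implicit Defensive.

Import Order.TTheory GRing.Theory Num.Theory.
Local Open Scope ring_scope.

(* The vectors of diagonal entries [r] and [c] are row vectors because this is
   what [diag_mx] expects; the targets [R] and [C] are column vectors. *)
Definition is_sinkhorn_scaling (F : realType) (n m : nat)
    (A : 'M[F]_(n, m)) (R : 'cV[F]_n) (C : 'cV[F]_m) (S : 'M[F]_(n, m)) : Prop :=
  exists (r : 'rV[F]_n) (c : 'rV[F]_m),
    [/\ forall i, 0 < r 0 i,
        forall j, 0 < c 0 j,
        S = diag_mx r *m A *m diag_mx c,
        S *m const_mx 1 = R
      & S^T *m const_mx 1 = C].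

(* Definite description: the unique such [S]. The default value 0 is taken only
   if there is no such matrix or more than one; by Sinkhorn's theorem this does
   not happen when [A], [R], [C] are entrywise positive, n and m are positive,
   and [R] and [C] have the same total. *)
Definition sinkhorn_limit (F : realType) (n m : nat)
    (A : 'M[F]_(n, m)) (R : 'cV[F]_n) (C : 'cV[F]_m) : 'M[F]_(n, m) :=
  xget 0 (fun S => unique (is_sinkhorn_scaling A R C) S).

Definition mx22 (F : realType) (a b c d : F) : 'M[F]_2 :=
  \matrix_(i, j) if i == 0 then (if j == 0 then a else b)
                 else (if j == 0 then c else d).

(* Main.v *)
Require Import Defs.
From mathcomp Require Import all_boot all_order all_algebra ring lra.
From mathcomp Require Import all_classical reals.

(** A positive matrix S is a diagonal scaling of a positive 2 x 2 matrix A
    exactly when it has the same cross ratio s11 s22 / (s12 s21) = alpha / beta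
    ([sinkhorn_scaling22P]).  So the scalings with the prescribed margins are
    the positive points of the line of matrices with these margins that satisfy
    alpha s12 s21 = beta s11 s22, a quadratic equation in s22 alone.

    The left-hand side minus the right-hand side is positive at the end of the
    positive segment where s22 or s11 vanishes, and negative at the end where
    s21 or s12 vanishes; by the intermediate value property the equation has a
    positive solution ([positive_cross_ratio_exists]).

    The quadratic formula would leave a choice of sign.  At a positive solution,
    however, the derivative of the quadratic is minus the positive number
    alpha (s12 + s21) + beta (s11 + s22), and its square is the discriminant:
    hence this number is the square root of Delta
    ([sqrt_discriminant_margins]).  The margins together with this relation are
    linear equations for the entries of S, with a unique solution because
    det A != 0: it is the stated matrix.  This proves the formula and
    uniqueness at once, without a discussion of the sign of det A. *)

Set Implicit Arguments.
Unset Strict Implicit.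
Unset Printing Implicit Defensive.

Import Order.TTheory GRing.Theory Num.Theory.
Local Open Scope ring_scope.

Lemma forall_ord2 (P : 'I_2 -> Prop) : P 0 -> P 1 -> forall i, P i.
Proof.
move=> P0 P1; case=> -[|[|//]] lt_i2.
- by have -> : Ordinal lt_i2 = 0 by apply: val_inj.
- by have -> : Ordinal lt_i2 = 1 by apply: val_inj.
Qed.

Lemma det_mx22 (F : realType) (a b c d : F) :
  \det (mx22 a b c d) = a * d - b * c.
Proof.
rewrite (expand_det_row _ 0) big_ord_recl big_ord1 /cofactor !det_mx11 !mxE /=.
by rewrite expr0 expr1 mul1r mulN1r mulrN.
Qed.

(** A scaling multiplies both a d and b c by the product of all four factors, so
    it keeps their ratio.  Conversely, factors can be chosen to match s11, s21
    and s12, and equality of the cross ratios then forces s22 to match too. *)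
Lemma sinkhorn_scaling22P (F : realType) (a b c d R1 R2 C1 C2 : F)
    (S : 'M[F]_2) :
  0 < a -> 0 < b -> 0 < c -> 0 < d ->
  is_sinkhorn_scaling (mx22 a b c d)
    (\col_i (if i == 0 then R1 else R2)) (\col_j (if j == 0 then C1 else C2)) S
  <->
  [/\ (forall i j, 0 < S i j),
      a * d * (S 0 1 * S 1 0) = b * c * (S 0 0 * S 1 1),
      S 0 0 + S 0 1 = R1 /\ S 1 0 + S 1 1 = R2
    & S 0 0 + S 1 0 = C1 /\ S 0 1 + S 1 1 = C2].
Proof.
move=> a_gt0 b_gt0 c_gt0 d_gt0.
have rowE i : (S *m const_mx 1 : 'cV_2) i 0 = S i 0 + S i 1.
  rewrite mxE big_ord_recl big_ord1 !mxE !mulr1.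
  by congr (_ + S _ _); apply: val_inj.
have colE j : (S^T *m const_mx 1 : 'cV_2) j 0 = S 0 j + S 1 j.
  rewrite mxE big_ord_recl big_ord1 !mxE !mulr1.
  by congr (_ + S _ _); apply: val_inj.
split=> [[r [k [r_gt0 k_gt0 defS defR defC]]]
        | [S_gt0 cross [sumR1 sumR2] [sumC1 sumC2]]].
  have SE i j : S i j = r 0 i * mx22 a b c d i j * k 0 j.
    by rewrite defS mul_mx_diag mxE mul_diag_mx mxE.
  split.
  - move=> i j; rewrite SE !mulr_gt0 //; move: i j.
    by do 2!apply: forall_ord2; rewrite mxE.
  - rewrite !SE !mxE /=; ring.
  - by rewrite -!rowE defR !mxE.
  - by rewrite -!colE defC !mxE.
have [a_neq0 b_neq0 c_neq0] : [/\ a != 0, b != 0 & c != 0].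
  by rewrite !lt0r_neq0.
have S00_neq0 := lt0r_neq0 (S_gt0 0 0).
(* The column factor of the first column is normalized to 1. *)
exists (\row_i (if i == 0 then S 0 0 / a else S 1 0 / c)).
exists (\row_j (if j == 0 then 1 else S 0 1 * a / (b * S 0 0))).
split.
- by apply: forall_ord2; rewrite mxE /= divr_gt0.
- by apply: forall_ord2; rewrite mxE //= divr_gt0 // mulr_gt0.
- apply/matrixP=> i j; rewrite mul_mx_diag mxE mul_diag_mx mxE; move: i j.
  do 2!apply: forall_ord2; rewrite !mxE /=.
  + by field.
  + by field; rewrite a_neq0 b_neq0 S00_neq0.
  + by field.
  + apply: (mulfI (mulf_neq0 (mulf_neq0 b_neq0 c_neq0) S00_neq0)).
    rewrite -mulrA -cross; field.
    by rewrite c_neq0 b_neq0 S00_neq0.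
- by apply/colP; apply: forall_ord2; rewrite rowE mxE.
- by apply/colP; apply: forall_ord2; rewrite colE mxE.
Qed.

(** Written in the entries s, t, u, v, Delta is the square of
    alpha (t + u) + beta (s + v) up to a multiple of the cross ratio relation,
    and positivity decides the sign of the square root. *)
Lemma sqrt_discriminant_margins (F : rcfType) (alpha beta s t u v : F) :
  0 < alpha -> 0 < beta -> 0 < s -> 0 < t -> 0 < u -> 0 < v ->
  alpha * (t * u) = beta * (s * v) ->
  Num.sqrt ((alpha * ((t + v) + (u + v)) + beta * ((s + u) - (u + v))) ^+ 2
            - 4 * alpha * (t + v) * (u + v) * (alpha - beta))
  = alpha * (t + u) + beta * (s + v).
Proof.
move=> alpha_gt0 beta_gt0 s_gt0 t_gt0 u_gt0 v_gt0 cross.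
rewrite -[RHS]ger0_norm; last by rewrite addr_ge0 // mulr_ge0 ?addr_ge0 ?ltW.
rewrite -sqrtr_sqr; congr Num.sqrt; apply/eqP; rewrite -subr_eq0; apply/eqP.
transitivity (4 * (alpha - beta) * (beta * (s * v) - alpha * (t * u))).
  by ring.
by rewrite cross subrr mulr0.
Qed.

(** With v as lower right entry, the margins make the other entries C2 - v,
    R2 - v and C1 - R2 + v; the bounds on v say that they are positive. *)
Lemma positive_cross_ratio_exists (F : rcfType) (alpha beta R1 R2 C1 C2 : F) :
  0 < alpha -> 0 < beta -> 0 < R1 -> 0 < R2 -> 0 < C1 -> 0 < C2 ->
  R1 + R2 = C1 + C2 ->
  exists v, [/\ 0 < v, v < R2, v < C2, R2 - C1 < v
              & alpha * ((C2 - v) * (R2 - v)) = beta * ((C1 - R2 + v) * v)].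
Proof.
move=> alpha_gt0 beta_gt0 R1_gt0 R2_gt0 C1_gt0 C2_gt0 sumRC.
pose p : {poly F} := beta *: (((C1 - R2)%:P + 'X) * 'X)
                     - alpha *: ((C2%:P - 'X) * (R2%:P - 'X)).
have pE x : p.[x] = beta * ((C1 - R2 + x) * x) - alpha * ((C2 - x) * (R2 - x)).
  by rewrite /p !hornerE.
(* At l one of the entries s11, s22 vanishes, at h one of s12, s21, and the
   remaining product of two entries is a product of margins. *)
pose l := Num.max 0 (R2 - C1); pose h := Num.min R2 C2.
have pl_lt0 : p.[l] < 0.
  rewrite pE /l; case: (leP 0 (R2 - C1)) => _.
    have -> : C2 - (R2 - C1) = R1 by lra.
    have := mulr_gt0 alpha_gt0 (mulr_gt0 R1_gt0 C1_gt0); lra.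
  have := mulr_gt0 alpha_gt0 (mulr_gt0 C2_gt0 R2_gt0); lra.
have ph_gt0 : 0 < p.[h].
  rewrite pE /h; case: (leP R2 C2) => _.
    have := mulr_gt0 beta_gt0 (mulr_gt0 C1_gt0 R2_gt0); lra.
  have -> : C1 - R2 + C2 = R1 by lra.
  have := mulr_gt0 beta_gt0 (mulr_gt0 R1_gt0 C2_gt0); lra.
have le_lh : l <= h.
  by rewrite ge_max !le_min; apply/andP; split; apply/andP; split; lra.
have [v /andP[le_lv le_vh] /rootP pv0] :=
  poly_ivt le_lh (introT andP (conj (ltW pl_lt0) (ltW ph_gt0))).
have lt_lv : l < v.
  rewrite lt_neqAle le_lv andbT; apply/eqP=> eq_lv.
  by rewrite eq_lv pv0 ltxx in pl_lt0.
have lt_vh : v < h.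
  rewrite lt_neqAle le_vh andbT; apply/eqP=> eq_vh.
  by rewrite -eq_vh pv0 ltxx in ph_gt0.
move: lt_lv lt_vh; rewrite gt_max lt_min => /andP[v_gt0 v_gt] /andP[vR vC].
exists v; split=> //; apply/esym/eqP.
by rewrite -subr_eq0 -pE pv0.
Qed.

Theorem theorem2p3p1 (F : realType) (a11 a12 a21 a22 R1 R2 C1 C2 : F)
    (A : 'M[F]_2) (R C : 'cV[F]_2)
    (alpha beta Delta : F)
    (def_A : A = mx22 a11 a12 a21 a22)
    (a11_gt0 : 0 < a11) (a12_gt0 : 0 < a12)
    (a21_gt0 : 0 < a21) (a22_gt0 : 0 < a22)
    (detA_neq0 : \det A != 0)
    (def_R : R = \col_i (if i == 0 then R1 else R2))
    (def_C : C = \col_j (if j == 0 then C1 else C2))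
    (R1_gt0 : 0 < R1) (R2_gt0 : 0 < R2)
    (C1_gt0 : 0 < C1) (C2_gt0 : 0 < C2)
    (sumRC : R1 + R2 = C1 + C2)
    (def_alpha : alpha = a11 * a22)
    (def_beta : beta = a12 * a21)
    (def_Delta : Delta = (alpha * (C2 + R2) + beta * (C1 - R2)) ^+ 2
                         - 4 * alpha * C2 * R2 * \det A) :
  sinkhorn_limit A R C =
    mx22
      ((alpha * (R2 - 2 * C1 - C2) + beta * (- R2 + C1) + Num.sqrt Delta)
         / (- 2 * \det A))
      ((alpha * (R2 - C2) + beta * (- R2 + C1 + 2 * C2) - Num.sqrt Delta)
         / (- 2 * \det A))
      ((alpha * (- R2 + C2) + beta * (R2 + C1) - Num.sqrt Delta)
         / (- 2 * \det A))
      ((alpha * (- R2 - C2) + beta * (R2 - C1) + Num.sqrt Delta)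
         / (- 2 * \det A)).
Proof.
have alpha_gt0 : 0 < alpha by rewrite def_alpha mulr_gt0.
have beta_gt0 : 0 < beta by rewrite def_beta mulr_gt0.
have detE : \det A = alpha - beta by rewrite def_A det_mx22 def_alpha def_beta.
rewrite detE in detA_neq0 def_Delta *.
set L := mx22 _ _ _ _.
have scalingE S : is_sinkhorn_scaling A R C S -> S = L.
  rewrite def_A def_R def_C sinkhorn_scaling22P //.
  rewrite -def_alpha -def_beta => -[S_gt0 cross [sumR1 sumR2] [sumC1 sumC2]].
  have sqrtE : Num.sqrt Delta
             = alpha * (S 0 1 + S 1 0) + beta * (S 0 0 + S 1 1).
    by rewrite def_Delta -sumR2 -sumC1 -sumC2 sqrt_discriminant_margins.
  apply/matrixP; do 2!apply: forall_ord2; rewrite mxE /= sqrtE -sumR2 -sumC1;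
    rewrite -?sumC2; by field.
have [S scalingS] : exists S, is_sinkhorn_scaling A R C S.
  have [v [v_gt0 v_ltR v_ltC v_gt cross]] :=
    positive_cross_ratio_exists alpha_gt0 beta_gt0
      R1_gt0 R2_gt0 C1_gt0 C2_gt0 sumRC.
  exists (mx22 (C1 - R2 + v) (C2 - v) (R2 - v) v).
  rewrite def_A def_R def_C sinkhorn_scaling22P // -def_alpha -def_beta.
  split.
  - by do 2!apply: forall_ord2; rewrite mxE /=; lra.
  - by rewrite !mxE.
  - by rewrite !mxE /=; split; lra.
  - by rewrite !mxE /=; split; lra.
have scalingL : is_sinkhorn_scaling A R C L by rewrite -(scalingE S).
apply: xget_unique.
  by split=> // S' /scalingE.
by move=> S' [/scalingE].
Qed.
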